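(* Under the standing assumptions below, for every $\gamma\in\mathbb R^I_+$, $x_0\in\mathcal X$, $s_0\in\mathcal S$, the maximum value $V(\gamma,x_0,s_0)$ of the ex-ante lottery problem equals $D(\gamma,x_0,s_0)$.
   Context: Setup. Let $\mathcal S$ be a finite set and $(s_t)_{t\ge0}$ a Markov chain on $\mathcal S$ with transition probabilities $\pi(s'|s)>0$ for all $s,s'\in\mathcal S$; for $s^t=(s_0,\dots,s_t)\in\mathcal S^{t+1}$ write $\pi^t(s^t|s_0)$ for its probability given $s_0$ and $\mathbb E_{s^t}$ (or $\mathbb E_{s_t}$) for expectation over future shocks given $s^t$. Let $\mathcal A\subset\mathbb R^n$ be a finite set, $\mathcal X\subseteq\mathbb R^m$ a countable set, $\zeta:\mathcal X\times\mathcal A\times\mathcal S\to\mathcal X$, $p:\mathcal X\times\mathcal A\times\mathcal S\to\mathbb R$, $r,g^1,\dots,g^I$ bounded real functions on $\mathcal X\times\mathcal A\times\mathcal S$, $\bar g^i\in\mathbb R$, $\beta\in(0,1)$. A plan is $a=(a(s^t))_{t,s^t}$, $a(s^t)\in\mathcal A$, inducing $x(s^0)=x_0$, $x(s^{t+1})=\zeta(x(s^t),a(s^t),s_t)$. $\tilde{\mathcal A}(x,s)=\{a\in\mathcal A:p(x,a,s)\ge0\}$; $\tilde{\mathcal A}^\infty(x_0)$ is the set of plans with $a(s^t)\in\tilde{\mathcal A}(x(s^t),s_t)$ for all $t,s^t$. A plan is feasible for $(x_0,s_0)$ if it lies in $\tilde{\mathcal A}^\infty(x_0)$ and $\mathbb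 E_{s^t}\sum_{n\ge0}\beta^ng^i(x(s^{t+n}),a(s^{t+n}),s_{t+n})\ge\bar g^i$ for all $t,s^t,i$. Standing assumption: for every $(x_0,s_0)$ a feasible plan exists. Pre-action histories $h^t=(s_0,a_0,\dots,s_{t-1},a_{t-1},s_t)\in\mathcal H^t=\mathcal S^{t+1}\times\mathcal A^t$; a plan generates $h^t=(s_0,a(s^0),\dots,a(s^{t-1}),s_t)$ along $s^t$. Dual value: $\Lambda$ is the set of $(\lambda^i(h^t))_{t,h^t,i}$, $\lambda^i(h^t)\ge0$, $\sum_t\sum_{h^t}\sum_i\beta^t\lambda^i(h^t)\pi^t(s^t|s_0)<\infty$. $L(a,\lambda;\gamma,x_0,s_0)=\mathbb E_{s_0}\sum_t\beta^t\big[r(x(s^t),a(s^t),s_t)+\sum_i\gamma^ig^i(x(s^t),a(s^t),s_t)+\sum_i\lambda^i(h^t)(\sum_{n\ge0}\beta^ng^i(x(s^{t+n}),a(s^{t+n}),s_{t+n})-\bar g^i)\big]$ and $D(\gamma,x_0,s_0)=\inf_{\lambda\in\Lambda}\sup_{a\in\tilde{\mathcal A}^\infty(x_0)}L$. Ex-ante lottery problem. Give $\tilde{\mathcal A}^\infty(x_0)$ the product topology and let $\mathcal P(\tilde{\mathcal A}^\infty(x_0))$ be the set of Borel probability measures on it; a random plan $a\sim P$ is drawn independently of the shocks. For $\gamma\in\mathbb R^I$, the ex-ante lottery problem is to maximize $\mathbb E^{a\sim P}_{s_0}\sum_{t\ge0}\beta^t\big(r(x(s^t),a(s^t),s_t)+\sum_i\gamma^ig^i(x(s^t),a(s^t),s_t)\big)$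 over $P\in\mathcal P(\tilde{\mathcal A}^\infty(x_0))$ subject to: for all $t\ge0$, all $h^t=(s_0,\tilde a_0,\dots,s_{t-1},\tilde a_{t-1},s_t)\in\mathcal H^t$ and all $i$, $\mathbb E^{a\sim P}_{s^t}\Big[\mathbf 1\{(a(s^0),\dots,a(s^{t-1}))=(\tilde a_0,\dots,\tilde a_{t-1})\}\Big(\sum_{n\ge0}\beta^ng^i(x(s^{t+n}),a(s^{t+n}),s_{t+n})-\bar g^i\Big)\Big]\ge0$, where $s^t$ is the shock history contained in $h^t$ and the expectation is over $a\sim P$ and future shocks given $s^t$. (A maximizer exists.) *)

(* Defs.v *)
From HB Require Import structures.
From mathcomp Require Import all_boot all_order all_algebra.
From mathcomp Require Import all_classical all_reals all_analysis.

Set Implicit Arguments.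
Unset Strict Implicit.
Unset Printing Implicit Defensive.

Import Order.TTheory GRing.Theory Num.Theory.
Local Open Scope classical_set_scope.
Local Open Scope ring_scope.

(* Finite types with a distinguished point (the finite action set A;
   the point is needed only because MathComp-Analysis measurable types
   are pointed; A is nonempty anyway since feasible plans exist). *)
#[short(type="finPointedType")]
HB.structure Definition FinPointed := {T of Finite T & isPointed T}.

Definition rseries {R : realType} (u : nat -> R) : R :=
  limn (fun N => \sum_(0 <= k < N) u k).

Section Model.
Context {R : realType} {S : finType} {A : finPointedType} {X : countType}
  {nI : nat}.

(* A shock history s^t = (s_0, ..., s_t) is encoded as the pair
   (s_0, [:: s_1; ...; s_t]); so t = size h.2. *)
Definition shist := (S * seq S)%type.
Definition cur (h : shist) : S := last h.1 h.2.
Definition prefix (h : shist) (k : nat) : shist := (h.1, take k h.2).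
Definition extend (h : shist) (c : seq S) : shist := (h.1, h.2 ++ c).

Definition plan := shist -> A.

(* transition probabilities: pi s s' = pi(s'|s) *)
Fixpoint pathprob (pi : S -> S -> R) (s : S) (c : seq S) : R :=
  match c with
  | [::] => 1
  | s' :: c' => pi s s' * pathprob pi s' c'
  end.

Definition pit (pi : S -> S -> R) (s0 : S) (h : shist) : R :=
  if h.1 == s0 then pathprob pi s0 h.2 else 0.

Definition condE (pi : S -> S -> R) (h : shist) (n : nat) (f : shist -> R) : R :=
  \sum_(c : n.-tuple S) pathprob pi (cur h) c * f (extend h c).

Fixpoint xk (zeta : X -> A -> S -> X) (x0 : X) (a : plan) (h : shist)
    (k : nat) : X :=
  match k with
  | 0 => x0
  | k'.+1 => zeta (xk zeta x0 a h k') (a (prefix h k')) (cur (prefix h k'))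
  end.

Definition xof (zeta : X -> A -> S -> X) (x0 : X) (a : plan) (h : shist) : X :=
  xk zeta x0 a h (size h.2).

Definition contval (pi : S -> S -> R) (zeta : X -> A -> S -> X) (beta : R)
    (x0 : X) (a : plan) (f : X -> A -> S -> R) (h : shist) : R :=
  rseries (fun n => beta ^+ n *
    condE pi h n (fun h' => f (xof zeta x0 a h') (a h') (cur h'))).

Definition Ainf (zeta : X -> A -> S -> X) (p : X -> A -> S -> R) (x0 : X)
  : set plan :=
  [set a | forall h : shist, 0 <= p (xof zeta x0 a h) (a h) (cur h)].

Definition feasible_plan (pi : S -> S -> R) (zeta : X -> A -> S -> X)
    (p : X -> A -> S -> R) (g : 'I_nI -> X -> A -> S -> R) (gbar : 'I_nI -> R)
    (beta : R) (x0 : X) (s0 : S) : set plan :=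
  [set a | Ainf zeta p x0 a /\
    forall (h : shist) (i : 'I_nI), gbar i <= contval pi zeta beta x0 a (g i) h].

Definition acts (a : plan) (h : shist) : seq A :=
  [seq a (prefix h k) | k <- iota 0 (size h.2)].

(* pre-action histories h^t = (s_0,a_0,...,s_{t-1},a_{t-1},s_t), encoded as
   (s^t, [:: a_0; ...; a_{t-1}]) with matching lengths *)
Definition preh := {hp : shist * seq A | size hp.2 == size hp.1.2}.

Lemma acts_size (a : plan) (h : shist) : size (h, acts a h).2 == size (h, acts a h).1.2.
Proof. by rewrite /= size_map size_iota. Qed.

Definition genh (a : plan) (h : shist) : preh := exist _ (h, acts a h) (acts_size a h).

Lemma tuple_size t (tl : t.-tuple S) (ac : t.-tuple A) :
  size ((tl : seq S), (ac : seq A)).2 == size ((tl : seq S), (ac : seq A)).1.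
Proof. by rewrite /= !size_tuple. Qed.

Definition mkpreh t (s : S) (tl : t.-tuple S) (ac : t.-tuple A) : preh :=
  exist (fun hp : shist * seq A => size hp.2 == size hp.1.2)
    ((s, (tl : seq S)), (ac : seq A)) (tuple_size tl ac).

Definition Lambda (pi : S -> S -> R) (beta : R) (s0 : S)
  : set ('I_nI -> preh -> R) :=
  [set lam | (forall i hp, 0 <= lam i hp) /\
    (\sum_(0 <= t <oo)
       (beta ^+ t * \sum_(s : S) \sum_(tl : t.-tuple S) \sum_(ac : t.-tuple A)
          \sum_(i < nI) lam i (mkpreh s tl ac) * pit pi s0 (s, (tl : seq S)))%:E
     < +oo)%E].

Definition Lagr (pi : S -> S -> R) (zeta : X -> A -> S -> X)
    (r : X -> A -> S -> R) (g : 'I_nI -> X -> A -> S -> R) (gbar : 'I_nI -> R)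
    (beta : R) (gamma : 'I_nI -> R) (x0 : X) (s0 : S)
    (a : plan) (lam : 'I_nI -> preh -> R) : R :=
  rseries (fun t => beta ^+ t * condE pi (s0, [::]) t (fun h =>
      r (xof zeta x0 a h) (a h) (cur h)
    + \sum_(i < nI) gamma i * g i (xof zeta x0 a h) (a h) (cur h)
    + \sum_(i < nI) lam i (genh a h) *
        (contval pi zeta beta x0 a (g i) h - gbar i))).

Definition Dval (pi : S -> S -> R) (zeta : X -> A -> S -> X)
    (p r : X -> A -> S -> R) (g : 'I_nI -> X -> A -> S -> R) (gbar : 'I_nI -> R)
    (beta : R) (gamma : 'I_nI -> R) (x0 : X) (s0 : S) : \bar R :=
  ereal_inf [set ereal_sup
      [set (Lagr pi zeta r g gbar beta gamma x0 s0 a lam)%:E | a in Ainf zeta p x0]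
    | lam in Lambda pi beta s0].

Definition planTop := {ptws shist -> discrete_topology A}.
Definition planM := g_sigma_algebraType (@open planTop).

Definition objective (pi : S -> S -> R) (zeta : X -> A -> S -> X)
    (r : X -> A -> S -> R) (g : 'I_nI -> X -> A -> S -> R) (beta : R)
    (gamma : 'I_nI -> R) (x0 : X) (s0 : S) (a : plan) : R :=
  contval pi zeta beta x0 a
    (fun x b s => r x b s + \sum_(i < nI) gamma i * g i x b s) (s0, [::]).

(* feasible lotteries: Borel probability measures on the plan space
   concentrated on \tilde A^\infty(x0) (i.e. elements of
   P(\tilde A^\infty(x0))) satisfying the ex-ante constraints at every
   pre-action history h^t *)
Definition feasible_lottery (pi : S -> S -> R) (zeta : X -> A -> S -> X)
    (p : X -> A -> S -> R) (g : 'I_nI -> X -> A -> S -> R) (gbar : 'I_nI -> R)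
    (beta : R) (x0 : X) (s0 : S) : set (probability planM R) :=
  [set P | P (Ainf zeta p x0 : set planM) = 1%E /\
    forall (hp : preh) (i : 'I_nI),
      (0 <= \int[P]_(a in [set: planM])
        ((acts a (sval hp).1 == (sval hp).2)%:R *
         (contval pi zeta beta x0 a (g i) (sval hp).1 - gbar i))%:E)%E].

Definition Vlot (pi : S -> S -> R) (zeta : X -> A -> S -> X)
    (p r : X -> A -> S -> R) (g : 'I_nI -> X -> A -> S -> R) (gbar : 'I_nI -> R)
    (beta : R) (gamma : 'I_nI -> R) (x0 : X) (s0 : S) : \bar R :=
  ereal_sup [set (\int[P]_(a in [set: planM])
                    (objective pi zeta r g beta gamma x0 s0 a)%:E)%E
            | P in feasible_lottery pi zeta p g gbar beta x0 s0].

End Model.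

(* Main.v *)
Require Import Defs.
From HB Require Import structures.
From mathcomp Require Import all_boot all_order all_algebra.
From mathcomp Require Import all_classical all_reals all_analysis.
From mathcomp Require Import measurable_realfun ring lra.
Import Order.TTheory GRing.Theory Num.Theory.
Import numFieldNormedType.Exports.
Local Open Scope classical_set_scope.
Local Open Scope ring_scope.
Set Implicit Arguments.
Unset Strict Implicit.
Unset Printing Implicit Defensive.

(** [V <= D] is weak duality: the Lagrangian is integrated term by term against
    a feasible lottery, after truncation at a horizon beyond which it is
    uniformly small.

    For [D <= V], let [v < D].  For each horizon [T] play a repeated game with
    payoff vector (objective minus [v], slack of every constraint up to [T]).
    Answering the negative part of the accumulated payoff, read as a vector of
    multipliers, is possible because [v < D] (or, when the objective gets
    weight zero, because a feasible plan exists), so by Blackwell's argument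
    the empirical distribution of the answers violates every constraint by a
    vanishing amount.  No finite-dimensional separation theorem is needed.
    A limit along an ultrafilter of these empirical distributions is a finitely
    additive function on cylinder sets; compactness of the plan space makes it
    countably additive, and its extension is a feasible lottery of value at
    least [v]. *)

(** * Cylinder sets of plans *)

Section Cylinders.
Context {S : finType} {A : finPointedType}.
Local Notation plan := (@plan S A).

Definition agree (n : nat) (a b : plan) : Prop :=
  forall h : shist, (size h.2 <= n)%N -> a h = b h.

Lemma agreeW m n a b : (m <= n)%N -> agree n a b -> agree m a b.
Proof. by move=> mn ab h hm; apply: ab; exact: leq_trans mn. Qed.

(* With [T := Prop], a cylinder is a cylinder set of plans. *)
Definition cylinder {T : Type} (f : plan -> T) : Prop :=
  exists n, forall a b, agree n a b -> f a = f b.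

Lemma cylinder_cst T (c : T) : cylinder (fun=> c).
Proof. by exists 0. Qed.

Lemma cylinder_comp T U (f : T -> U) (u : plan -> T) :
  cylinder u -> cylinder (f \o u).
Proof. by case=> n un; exists n => a b /un /= ->. Qed.

Lemma cylinder_comp2 T1 T2 U (f : T1 -> T2 -> U) u v :
  cylinder u -> cylinder v -> cylinder (fun a => f (u a) (v a)).
Proof.
move=> [n un] [m vm]; exists (maxn n m) => a b ab.
by rewrite (un a b) ?(vm a b)//; apply: agreeW ab; rewrite ?leq_maxl ?leq_maxr.
Qed.

Lemma cylinder_sum (R : realType) I (s : seq I) (f : I -> plan -> R) :
  (forall i, cylinder (f i)) -> cylinder (fun a => \sum_(i <- s) f i a).
Proof.
move=> cf; elim: s => [|i s IH].
  by exists 0%N => a b _; rewrite !big_nil.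
have [n fn] := cylinder_comp2 +%R (cf i) IH.
by exists n => a b /fn; rewrite !big_cons.
Qed.

Lemma cylinder_setC (C : set plan) : cylinder C -> cylinder (~` C).
Proof. exact: cylinder_comp. Qed.

Lemma cylinder_setU (C D : set plan) :
  cylinder C -> cylinder D -> cylinder (C `|` D).
Proof. exact: cylinder_comp2. Qed.

Lemma cylinder_preimage T (f : plan -> T) (D : set T) :
  cylinder f -> cylinder (f @^-1` D).
Proof. exact: cylinder_comp. Qed.

Definition trunc (n : nat) : Type := {ffun S * n.-bseq S -> A}.
HB.instance Definition _ n := Finite.on (trunc n).

Definition truncate n (a : plan) : trunc n :=
  [ffun x : S * n.-bseq S => a (x.1, (x.2 : seq S))].

(** The default [point] past depth [n] is harmless: only the values up to depth [n] are ever
    used. *)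
Definition untruncate n (w : trunc n) : plan :=
  fun h => if insub h.2 is Some b then w (h.1, b) else point.

Lemma truncateK n a : agree n (untruncate (truncate n a)) a.
Proof.
case=> s c /= cn; rewrite /untruncate /=.
by rewrite insubT /= ffunE.
Qed.

Lemma agree_truncate n a b : agree n a b -> truncate n a = truncate n b.
Proof. by move=> ab; apply/ffunP => x; rewrite !ffunE ab//= size_bseq. Qed.

Lemma cylinder_truncate n : cylinder (truncate n).
Proof. by exists n => a b /agree_truncate. Qed.

(** A cylinder function factors through the finite type [trunc n], so the sum of all its absolute
    values is a bound. *)
Lemma cylinder_bounded (R : realType) (f : plan -> R) : cylinder f ->
  exists M, forall a, `|f a| <= M.
Proof.
case=> n fn; exists (\sum_(w : trunc n) `|f (untruncate w)|) => a.
rewrite -(fn _ _ (truncateK a)) (bigD1 (truncate n a))//= lerDl.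
by apply: sumr_ge0.
Qed.

(** If no value were taken [U]-often, the finitely many complements would meet in a set of [U], yet
    that intersection is empty. *)
Lemma ultra_finite (T : finType) (U : set_system nat) (u : nat -> T) :
  UltraFilter U -> exists x, U [set k | u k = x].
Proof.
move=> UU; apply: contrapT => /forallNP Ux.
have : U [set k | forall x, x \in enum T -> u k <> x].
  elim: (enum T) => [|x s IH]; first exact: filterE.
  have [/Ux//|] := in_ultra_setVsetC [set k | u k = x] UU.
  apply: filterS2 IH => k /= ks kx y; rewrite inE => /orP[/eqP ->//|].
  exact: ks.
move=> /filter_ex[k /= /(_ (u k))]; apply=> //; exact: mem_enum.
Qed.

(** Compactness of the plan space: the limit plan is chosen history by history, and agreement to
    depth [n] is uniform because the truncations also have a [U]-limit in a finite type. *)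
Lemma ultra_agree (U : set_system nat) (u : nat -> plan) : UltraFilter U ->
  exists a, forall n, U [set k | agree n a (u k)].
Proof.
move=> UU; have /choice[a Ha] h := ultra_finite (fun k => u k h) UU.
exists a => n.
have [w Hw] := ultra_finite (fun k => truncate n (u k)) UU.
suff aw : agree n a (untruncate w).
  apply: filterS Hw => k /= kw h hn; rewrite aw// -kw.
  exact: truncateK.
move=> h hn; have [k [/= kw kh]] := filter_ex (filterI Hw (Ha h)).
by rewrite -kh -kw truncateK.
Qed.

(** Were there no finite subcover, points [u N] of [C] outside the first [N] sets would have an
    ultralimit in [C], hence in some [F k]; as [F k] is a cylinder, some [u j] with [j > k] would
    lie in it too. *)
Lemma cylinder_compact (C : set plan) (F : nat -> set plan) :
  cylinder C -> (forall k, cylinder (F k)) -> C `<=` \bigcup_k F k ->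
  exists N, C `<=` \bigcup_(k < N) F k.
Proof.
move=> [n Cn] cF CF; apply: contrapT => /forallNP nC.
have /choice[u Hu] N : exists a, C a /\ ~ (\bigcup_(k < N) F k) a.
  by have /existsNP[a /not_implyP] := nC N; exists a.
have [U [UU sU]] := @ultraFilterLemma nat \oo _.
have [a aU] := ultra_agree u UU.
have /CF[k _ Fka] : C a.
  have /filter_ex[k /Cn ->] := aU n; exact: (Hu k).1.
have [m Fm] := cF k.
have kU : U [set j | (k < j)%N] by apply: sU; exact: nbhs_infty_gt.
have [j [/= /Fm aj kj]] := filter_ex (filterI (aU m) kU).
by apply: (Hu j).2; exists k => //; rewrite -aj.
Qed.

End Cylinders.

(** * The algebra of cylinder sets *)

Section CylinderAlgebra.
Context {S : finType} {A : finPointedType}.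

(** A second name for plans, which carries the algebra of cylinders apart from the Borel
    sigma-algebra of [planM]. *)
Definition cylplan : Type := @plan S A.
HB.instance Definition _ := Pointed.on cylplan.

Definition cyl_display : measure_display.
Proof. exact. Qed.

Lemma cylinder_set0 : cylinder (set0 : set (@plan S A)).
Proof. exact: cylinder_cst. Qed.

HB.instance Definition _ := isAlgebraOfSets.Build cyl_display cylplan
  cylinder_set0 (@cylinder_setU S A) (@cylinder_setC S A).

End CylinderAlgebra.

(** * Cylinders in the product topology *)

Section CylinderTopology.
Context {S : finType} {A : finPointedType}.
Local Notation planTop := (@planTop S A).

Lemma open_coord (h : @shist S) (x : A) : @open planTop [set a | a h = x].
Proof.
have ch : continuous (fun a : planTop => a h : discrete_topology A).
  exact: (@proj_continuous (@shist S) (fun=> discrete_topology A) h).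
apply: (@open_comp _ _ (fun a : planTop => a h : discrete_topology A) [set x]).
  by move=> a _; exact: ch.
exact: discrete_open.
Qed.

Lemma cylinder_open (C : set planTop) : cylinder C -> open C.
Proof.
move=> [n Cn]; rewrite openE => a Ca.
have ax (x : S * n.-bseq S) :
    nbhs a [set b : planTop | b (x.1, x.2 : seq S) = a (x.1, x.2 : seq S)].
  by apply: open_nbhs_nbhs; split => //; exact: open_coord.
have := filter_forall (nbhs_filter _) ax; apply: filterS => b /= ab.
rewrite -(Cn a b)// => -[s c] /= cn.
exact/esym/(ab (s, Bseq cn)).
Qed.

Lemma cylinder_measurable (C : set (@planM S A)) :
  cylinder C -> measurable C.
Proof. by move=> /cylinder_open oC; exact: sub_sigma_algebra. Qed.

(** Plans outside [O] that agree with [a] to ever greater depth converge to [a], which is impossible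
    for [a] in [O]. The union is countable, so cylinders generate the Borel sets. *)
Lemma open_bigcup_cylinder (O : set planTop) : open O ->
  O = \bigcup_n [set a | forall b, agree n a b -> O b].
Proof.
rewrite openE => oO; apply/seteqP; split=> a; last by case=> n _; apply.
move=> /oO Oa; apply: contrapT => aO.
have /choice[u Hu] n : exists b, agree n a b /\ ~ O b.
  apply: contrapT => /forallNP nO; apply: aO; exists n => // b ab.
  by apply: contrapT => Ob; exact: (nO b).
(* Convergence is tested at each history [h], where [u n] is constant from [n = size h.2] on. *)
have ua : (u @ \oo) --> (a : planTop).
  apply/cvg_sup => h; apply/cvg_image.
    by apply/seteqP; split=> // x _; exists (fun=> x).
  move=> B /nbhs_singleton Bah; exists [set b | B (b h)].
    exists (size h.2) => // n /= hn.
    by rewrite -(Hu n).1.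
  by apply/seteqP; split=> [_ [b Bb <-]//|x Bx]; exists (fun=> x).
have [n _ /(_ n (leqnn n))] := ua _ Oa.
exact: (Hu n).2.
Qed.

End CylinderTopology.

(** * From finitely additive functions on cylinders to Borel probabilities *)

Section Extension.
Context {R : realType} {S : finType} {A : finPointedType}.
Variable q : set (@plan S A) -> R.
Hypothesis q_ge0 : forall C, 0 <= q C.
Hypothesis q1 : q setT = 1.
Hypothesis qU : forall C D, C `&` D = set0 -> q (C `|` D) = q C + q D.

Let mu (C : set (@cylplan S A)) : \bar R := (q C)%:E.

Let q0 : q set0 = 0.
Proof. by have := qU (setI0 set0); rewrite setU0; lra. Qed.

Let mu_ge0 C : (0 <= mu C)%E. Proof. by rewrite lee_fin. Qed.

Let mu_additive : measure_function.semi_additive mu.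
Proof.
move=> F n _ tF _; rewrite /mu sumEFin; congr (_%:E).
elim: n => [|n IH]; first by rewrite !big_ord0.
rewrite !big_ord_recr /= -IH qU//.
rewrite -bigcup_mkord; apply/seteqP; split=> // x [[k /= kn Fk] Fn].
have FF : F k `&` F n = set0.
  by move/trivIsetP: tF; apply => //; rewrite ltn_eqF.
by suff : (F k `&` F n) x by rewrite FF.
Qed.

HB.instance Definition _ := isContent.Build _ _ _ mu mu_ge0 mu_additive.

(** By compactness a countable cover of a cylinder by cylinders has a finite subcover, so finite
    subadditivity suffices. *)
Let mu_sigma_subadditive : measurable_subset_sigma_subadditive mu.
Proof.
move=> C F mF mC CF.
have [N CN] := cylinder_compact mC mF CF.
apply: (@le_trans _ _ (\sum_(k < N) mu (F k))%E).
  apply: content_subadditive => //.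
  by rewrite -bigcup_mkord.
rewrite -(big_mkord xpredT (mu \o F)).
by apply: nneseries_lim_ge => k _ _; exact: mu_ge0.
Qed.

HB.instance Definition _ :=
  Content_SigmaSubAdditive_isMeasure.Build _ _ _ mu mu_sigma_subadditive.

Let sub_measurable (C : set (@planM S A)) : measurable C ->
  @measurable _ (g_sigma_algebraType (@measurable _ (@cylplan S A))) C.
Proof.
apply: smallest_sub; first exact: smallest_sigma_algebra.
move=> O /open_bigcup_cylinder ->.
apply: bigcupT_measurable => n; apply: sub_sigma_algebra.
exists n => a b ab; apply/propext; split=> /= Oa c.
  by move=> bc; apply: Oa => h hn; rewrite ab// bc.
by move=> bc; apply: Oa => h hn; rewrite -ab// bc.
Qed.

(** The Carathéodory extension of [mu], read as a set function on the Borel space of plans. *)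
Let P (C : set (@planM S A)) : \bar R := measure_extension mu C.

Let P0 : P set0 = 0%E. Proof. exact: measure0. Qed.

Let P_ge0 C : (0 <= P C)%E. Proof. exact: measure_ge0. Qed.

Let P_sigma_additive : measure_function.semi_sigma_additive P.
Proof.
move=> F mF tF mUF; apply: measure_semi_sigma_additive => //.
  by move=> i; apply: sub_measurable.
exact: sub_measurable.
Qed.

HB.instance Definition _ := isMeasure.Build _ _ _ P P0 P_ge0 P_sigma_additive.

Let PE C : cylinder C -> P C = (q C)%:E.
Proof. by move=> cC; rewrite /P /measure_extension measurable_mu_extE. Qed.

Let P1 : P setT = 1%E.
Proof. by rewrite PE ?q1//; exact: cylinder_cst. Qed.

HB.instance Definition _ := Measure_isProbability.Build _ _ _ P P1.

Lemma cylinder_extension : exists P : probability (@planM S A) R,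
  forall C, cylinder C -> P C = (q C)%:E.
Proof. by exists P. Qed.

End Extension.

(** * Expectations of uniform limits of cylinder functions *)

Section Tame.
Context {R : realType} {S : finType} {A : finPointedType}.
Local Notation plan := (@plan S A).

(* By compactness of the plan space this is continuity for the product
   topology, in a form that needs no topology. *)
Definition tame (f : plan -> R) : Prop := forall e, 0 < e ->
  exists2 g, cylinder g & forall a, `|f a - g a| <= e.

Lemma tame_cylinder f : cylinder f -> tame f.
Proof. by move=> cf e e0; exists f => // a; rewrite subrr normr0 ltW. Qed.

Lemma tameD f g : tame f -> tame g -> tame (fun a => f a + g a).
Proof.
move=> tf tg e e0; have e2 : 0 < e / 2 by rewrite divr_gt0.
have [f' cf ff] := tf _ e2; have [g' cg gg] := tg _ e2.
exists (fun a => f' a + g' a); first exact: cylinder_comp2.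
move=> a; rewrite opprD addrACA (le_trans (ler_normD _ _))//.
by rewrite [leRHS]splitr lerD.
Qed.

Lemma tame_bounded f : tame f -> exists M, forall a, `|f a| <= M.
Proof.
move=> /(_ 1 ltr01)[g cg fg]; have [M gM] := cylinder_bounded cg.
exists (1 + M) => a; rewrite -(subrK (g a) (f a)).
by rewrite (le_trans (ler_normD _ _))// lerD.
Qed.

Lemma cylinderM_tame c f : cylinder c -> tame f -> tame (fun a => c a * f a).
Proof.
move=> cc tf e e0; have [M cM] := cylinder_bounded cc.
(* A positive divisor, whatever the bound [M] is. *)
have M1 : 0 < `|M| + 1 by rewrite ltr_wpDl.
have [|g cg fg] := tf (e / (`|M| + 1)); first by rewrite divr_gt0.
exists (fun a => c a * g a); first exact: cylinder_comp2.
move=> a; rewrite -mulrBr normrM.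
rewrite (@le_trans _ _ ((`|M| + 1) * (e / (`|M| + 1))))//; last first.
  by rewrite mulrC divfK// gt_eqF.
apply: ler_pM => //; rewrite (le_trans (cM a))// (le_trans (ler_norm _))//.
by rewrite lerDl.
Qed.

Lemma tameZ (k : R) f : tame f -> tame (fun a => k * f a).
Proof. by apply: cylinderM_tame; exact: cylinder_cst. Qed.

Lemma tame_cst (k : R) : tame (fun=> k).
Proof. by apply: tame_cylinder; exact: cylinder_cst. Qed.

Lemma tameB f g : tame f -> tame g -> tame (fun a => f a - g a).
Proof.
move=> tf tg; apply: tameD => //.
by under eq_fun do rewrite -mulN1r; exact: tameZ.
Qed.

Lemma tame_sum I (s : seq I) (f : I -> plan -> R) :
  (forall i, tame (f i)) -> tame (fun a => \sum_(i <- s) f i a).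
Proof.
move=> tf; elim: s => [|i s IH].
  by under eq_fun do rewrite big_nil; exact: tame_cst.
by under eq_fun do rewrite big_cons; exact: tameD.
Qed.

Lemma cylinder_indic (C : set plan) : cylinder C -> cylinder (\1_C : plan -> R).
Proof.
move=> [n Cn]; exists n => a b /Cn ab; rewrite !indicE.
have -> // : (a \in C) = (b \in C).
by apply/idP/idP => /set_mem Cx; apply/mem_set; rewrite ?ab// -ab.
Qed.

Lemma cylinder_measurable_fun (f : @planM S A -> R) :
  cylinder f -> measurable_fun setT f.
Proof.
move=> cf _ B mB; rewrite setTI; apply: cylinder_measurable.
exact: cylinder_preimage.
Qed.

Lemma tame_measurable (f : @planM S A -> R) : tame f -> measurable_fun setT f.
Proof.
move=> tf.
have /choice[g /all_and2[cg fg]] n : exists g, cylinder g /\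
    forall a, `|f a - g a| <= n.+1%:R^-1.
  by have [|g ? ?] := tf n.+1%:R^-1; [rewrite invr_gt0|exists g].
apply: (@measurable_fun_cvg _ (@planM S A) R setT g f).
  by move=> m; exact: cylinder_measurable_fun.
move=> a _; apply/cvgrPdist_le => e e0; near=> n.
rewrite (le_trans (fg n a))// ltW//; near: n.
exact: (near_infty_natSinv_lt (PosNum e0)).
Unshelve. all: by end_near. Qed.

Variable P : probability (@planM S A) R.

Lemma tame_integrable (f : @planM S A -> R) :
  tame f -> P.-integrable setT (EFin \o f).
Proof.
move=> tf; apply: measurable_bounded_integrable => //.
- by apply: fin_num_fun_lty; exact: fin_num_measure.
- exact: tame_measurable.
- have [M fM] := tame_bounded tf; exists M; split; first exact: num_real.
  by move=> x Mx a _; exact: le_trans (fM a) (ltW Mx).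
Qed.

Definition expect (f : @planM S A -> R) : R := \int[P]_a f a.

Lemma integral_expect f : tame f ->
  (\int[P]_a (f a)%:E)%E = (expect f)%:E.
Proof.
move=> tf; rewrite fineK//; apply: integrable_fin_num => //.
exact: tame_integrable.
Qed.

Lemma expectD f g : tame f -> tame g ->
  expect (fun a => f a + g a) = expect f + expect g.
Proof.
by move=> tf tg; rewrite /expect RintegralD//; exact: tame_integrable.
Qed.

Lemma expectZ k f : tame f -> expect (fun a => k * f a) = k * expect f.
Proof. by move=> tf; rewrite /expect RintegralZl//; exact: tame_integrable. Qed.

Lemma expect_cst k : expect (fun=> k) = k.
Proof.
rewrite /expect Rintegral_cst//.
have P1 := congr1 (fun x => k * fine x) (probability_setT P).
by rewrite [LHS]P1 mulr1.
Qed.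

Lemma expectB f g : tame f -> tame g ->
  expect (fun a => f a - g a) = expect f - expect g.
Proof.
by move=> tf tg; rewrite /expect RintegralB//; exact: tame_integrable.
Qed.

Lemma expect_sum I (s : seq I) (f : I -> @planM S A -> R) :
  (forall i, tame (f i)) ->
  expect (fun a => \sum_(i <- s) f i a) = \sum_(i <- s) expect (f i).
Proof.
move=> tf; elim: s => [|i s IH].
  by rewrite big_nil -[RHS](expect_cst 0); under eq_fun do rewrite big_nil.
rewrite big_cons -IH -expectD//; last exact: tame_sum.
by under eq_fun do rewrite big_cons.
Qed.

(** The complement of [K] is negligible, so a comparison on the admissible plans alone will do. *)
Lemma expect_le (K : set (@planM S A)) f g : measurable K -> P K = 1%E ->
  tame f -> tame g -> (forall a, K a -> f a <= g a) -> expect f <= expect g.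
Proof.
move=> mK PK tf tg fg; rewrite -subr_ge0 -expectB//.
rewrite -lee_fin -integral_expect; last exact: tameB.
have PK0 : P (~` K) = 0%E.
  by rewrite (probability_setC P mK) PK subee.
rewrite [leRHS](negligible_integral (measurableC mK) measurableT _ PK0).
  apply: integral_ge0 => a [_ /contrapT Ka].
  by rewrite lee_fin subr_ge0 fg.
by apply: tame_integrable; exact: tameB.
Qed.

Lemma expect_indic (C : set (@planM S A)) : cylinder C ->
  expect \1_C = fine (P C).
Proof.
move=> cC; rewrite /expect /Rintegral integral_indic ?setIT//.
exact: cylinder_measurable.
Qed.

End Tame.

(** * Limits of empirical distributions *)

(** A cluster point in the compact interval exists, and a cluster point of an ultrafilter is its
    limit. *)
Lemma ultra_bounded_cvg (R : realType) (U : set_system nat) (u : nat -> R) M :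
  UltraFilter U -> (forall n, `|u n| <= M) -> cvg (u @ U).
Proof.
move=> UU uM.
have UM : (u @ U) [set` `[- M, M]].
  have uMn n : [set` `[- M, M]] (u n) by rewrite /= in_itv /= -ler_norml uM.
  exact: (@filterE _ U _ _ uMn).
have [x [_ xU]] := @segment_compact R (- M) M (u @ U) _ UM.
apply/cvg_ex; exists x => B Bx.
have [//|UB] := in_ultra_setVsetC (u @^-1` B) UU.
by have [y []] := xU (~` B) B UB Bx.
Qed.

Section UltraLimit.
Context {R : realType} {S : finType} {A : finPointedType}.
Local Notation plan := (@plan S A).
Variable l : nat -> seq plan.
Hypothesis l_gt0 : forall n, (0 < size (l n))%N.
Variable U : set_system nat.
Hypothesis UU : UltraFilter U.

Definition average (n : nat) (f : plan -> R) : R :=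
  (\sum_(a <- l n) f a) / (size (l n))%:R.

Let size_gt0 n : 0 < (size (l n))%:R :> R.
Proof. by rewrite ltr0n. Qed.

Lemma averageD n f g :
  average n (fun a => f a + g a) = average n f + average n g.
Proof. by rewrite /average big_split mulrDl. Qed.

Lemma averageZ n k f : average n (fun a => k * f a) = k * average n f.
Proof. by rewrite /average -mulr_sumr mulrA. Qed.

Lemma average_cst n k : average n (fun=> k) = k.
Proof.
rewrite /average big_const_seq count_predT iter_addr addr0.
by rewrite -[k *+ _]mulr_natr mulfK// gt_eqF.
Qed.

Lemma average_sum n I (s : seq I) (f : I -> plan -> R) :
  average n (fun a => \sum_(i <- s) f i a) = \sum_(i <- s) average n (f i).
Proof. by rewrite /average exchange_big /= mulr_suml. Qed.

Lemma average_le n f g : {in l n, forall a, f a <= g a} ->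
  average n f <= average n g.
Proof.
move=> fg; rewrite /average ler_pM2r ?invr_gt0//.
by rewrite big_seq [leRHS]big_seq ler_sum.
Qed.

(** Limiting frequency of [C] in the lists; the ultrafilter gives all these limits at once, with no
    subsequences. *)
Let q (C : set plan) : R := lim (average n \1_C @[n --> U]).

Let q_cvg C : average n \1_C @[n --> U] --> q C.
Proof.
apply: (@ultra_bounded_cvg R U _ 1) => // n.
rewrite ler_norml; apply/andP; split.
  rewrite (@le_trans _ _ 0)//.
  rewrite -(average_cst n 0); apply: average_le => a _.
  by rewrite indicE ler0n.
rewrite -(average_cst n 1); apply: average_le => a _.
by rewrite indicE; case: (_ \in _).
Qed.

Let q_ge0 C : 0 <= q C.
Proof.
apply: (cvgr_to_ge (q_cvg (C := C))).
apply: filterE => n; rewrite -(average_cst n 0); apply: average_le => a _.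
by rewrite indicE ler0n.
Qed.

Let q1 : q setT = 1.
Proof.
apply/cvg_lim => //; have -> : (fun n => average n \1_setT) = (fun=> 1).
  by apply/funext => n; rewrite indicT average_cst.
exact: cvg_cst.
Qed.

Let qU C D : C `&` D = set0 -> q (C `|` D) = q C + q D.
Proof.
move=> CD; apply/cvg_lim => //.
have -> : (fun n => average n \1_(C `|` D)) =
    (fun n => average n \1_C + average n \1_D).
  apply/funext => n; rewrite -averageD; congr average; apply/funext => a.
  rewrite !indicE in_setU.
  have [aC|] := boolP (a \in C); have [aD|] := boolP (a \in D) => //=;
    rewrite ?addr0 ?add0r//.
  have CDa : (C `&` D) a by split; apply: set_mem.
  by rewrite CD in CDa.
exact: cvgD.
Qed.

(* A weak form of the compactness of the set of lotteries. *)
Theorem average_limit : exists P : probability (@planM S A) R,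
  (forall C, cylinder C -> (forall n, {in l n, forall a, C a}) ->
     P C = 1%E) /\
  (forall f c, tame f ->
     (forall e, 0 < e -> U [set n | c - e <= average n f]) -> c <= expect P f).
Proof.
have [P PE] := cylinder_extension q_ge0 q1 qU; exists P; split.
  move=> C cC lC; rewrite PE//; congr (_%:E); apply/cvg_lim => //.
  have -> : (fun n => average n \1_C) = (fun=> 1); last exact: cvg_cst.
  apply/funext => n; rewrite -[RHS](average_cst n).
  apply/eqP; rewrite eq_le !average_le// => a /lC/mem_set aC;
  by rewrite indicE aC.
(* A cylinder function is a finite combination of indicators of the cylinders that fix the
   truncation. *)
have cylinder_cvg f : cylinder f -> average n f @[n --> U] --> expect P f.
  move=> [m fm]; pose C (w : trunc m) : set plan := [set a | truncate m a = w].
  have cC w : cylinder (C w).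
    exact: (cylinder_preimage [set w] (cylinder_truncate m)).
  have fE : f = fun a =>
      \sum_(w <- index_enum (trunc m : finType)) f (untruncate w) * \1_(C w) a.
    apply/funext => a; rewrite (bigD1 (truncate m a))//= big1 ?addr0.
      by rewrite indicE mem_set// mulr1; exact/esym/fm/truncateK.
    by move=> w /eqP wa; rewrite indicE memNset ?mulr0// => /esym.
  have tC w : tame (\1_(C w) : plan -> R).
    exact/tame_cylinder/cylinder_indic.
  rewrite fE expect_sum; last by move=> w; exact: tameZ.
  under eq_fun do rewrite average_sum.
  apply: (cvg_big add_continuous) => w _; rewrite expectZ// expect_indic// PE//=.
  under eq_fun do rewrite averageZ.
  by apply: cvgM; [exact: cvg_cst|exact: q_cvg].
move=> f c tf fc; apply/ler_addgt0Pl => d d0.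
(* One third each for replacing [f] by [g] under [P], for replacing it in the averages, and for the
   slack in the hypothesis. *)
have d3 : 0 < d / 3 by rewrite divr_gt0.
have [g cg fg] := tf _ d3.
have fgd : expect P g - d / 3 <= expect P f.
  rewrite -(expect_cst P (d / 3)) -expectB;
    [|exact: tame_cylinder|exact: tame_cst].
  apply: (@expect_le _ _ _ P setT) => //.
  - exact: probability_setT.
  - by apply: tameB; [exact: tame_cylinder|exact: tame_cst].
  - by move=> a _; have := fg a; rewrite ler_norml; lra.
suff : c - d / 3 - d / 3 <= expect P g by lra.
apply: (cvgr_to_ge (cylinder_cvg _ cg)); apply: filterS (fc _ d3) => n /= cn.
rewrite lerBlDr (le_trans cn)//.
rewrite -[d / 3](average_cst n) -averageD; apply: average_le => a _.
by have := fg a; rewrite ler_norml; lra.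
Qed.

End UltraLimit.

(** * Approachability *)

Section Blackwell.
Context {R : realType} {J : Type} {T : eqType}.
(** [E] is a positive linear functional in the role of a weighted sum over the components [J], of
    which there may be infinitely many. *)
Variables (E : (J -> R) -> R) (K : set T) (f : T -> J -> R) (B : R).
Hypothesis E_add : forall u v, E (fun j => u j + v j) = E u + E v.
Hypothesis E_scale : forall k u, E (fun j => k * u j) = k * E u.
Hypothesis E_mono : forall u v, (forall j, u j <= v j) -> E u <= E v.
Hypothesis f_bounded : forall a j, K a -> `|f a j| <= B.
Hypothesis respond : forall lam : J -> R, (forall j, 0 <= lam j) ->
  exists2 a, K a & 0 <= E (fun j => lam j * f a j).

Definition negp (x : R) : R := Num.max 0 (- x).

Lemma negp_ge0 x : 0 <= negp x.
Proof. by rewrite /negp le_max lexx. Qed.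

(* The squared distance of [x + y] to the half-line is at most the squared
   distance of [x + y] to the projection of [x]. *)
Lemma negp_sqrD x y :
  negp (x + y) ^+ 2 <= negp x ^+ 2 + (- 2 * (negp x * y) + y ^+ 2).
Proof.
rewrite /negp.
have [] := leP 0 (- (x + y)); have [] := leP 0 (- x) => x0 xy0; nra.
Qed.

(* The respondent answers the multipliers given by the negative part of the
   accumulated payoff; then the squared distance to the nonnegative orthant
   grows at most linearly, and the averaged violation vanishes. *)
Lemma approachability n : exists l : seq T,
  [/\ size l = n, {in l, forall a, K a} &
      E (fun j => negp (\sum_(a <- l) f a j) ^+ 2) <= n%:R * E (fun=> B ^+ 2)].
Proof.
elim: n => [|n [l [ln lK El]]].
  exists [::]; split => //.
  rewrite mul0r -[leRHS](mul0r (E (fun=> 0))) -E_scale.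
  by apply: E_mono => j; rewrite big_nil /negp oppr0 maxxx expr0n mulr0.
have [a Ka aE] := respond (fun j => negp_ge0 (\sum_(b <- l) f b j)).
exists (a :: l); split; first by rewrite /= ln.
  by move=> b; rewrite inE => /orP[/eqP ->//|/lK].
pose u j := negp (\sum_(b <- l) f b j).
have step j : negp (\sum_(b <- a :: l) f b j) ^+ 2 <=
    u j ^+ 2 + (- 2 * (u j * f a j) + B ^+ 2).
  rewrite big_cons addrC (le_trans (negp_sqrD _ _))// !lerD2l.
  rewrite -real_normK ?num_real// lerXn2r ?nnegrE// ?f_bounded//.
  by rewrite (le_trans _ (f_bounded j Ka)).
apply: le_trans (E_mono step) _.
(* By [aE] the cross term is nonpositive, so a round adds at most [E (fun=> B ^+ 2)]. *)
rewrite E_add E_add E_scale -[n.+1%:R]natr1 mulrDl mul1r; move: El aE.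
rewrite -/u; lra.
Qed.

End Blackwell.

(** * Continuation values *)

Section SeriesTail.
Context {R : realType}.

Definition tail (w : nat -> R) (n : nat) : R :=
  rseries w - \sum_(0 <= k < n) w k.

Lemma tail_cvg0 w : cvgn (series w) -> tail w @ \oo --> 0.
Proof.
move=> cw; rewrite -[X in _ --> X](subrr (rseries w)).
by apply: cvgB => //; exact: cvg_cst.
Qed.

(** The error bound depends on the majorant only; this makes truncation uniform over plans. *)
Lemma rseries_tail (u w : nat -> R) : (forall n, `|u n| <= w n) ->
  cvgn (series w) ->
  cvgn (series u) /\
  forall n, `|rseries u - \sum_(0 <= k < n) u k| <= tail w n.
Proof.
move=> uw cw.
have cu : cvgn (series u).
  apply: normed_cvg; apply: (series_le_cvg _ _ _ cw) => k //=.
  by rewrite (le_trans _ (uw k)).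
split=> // n.
have cu' : (fun m => `|series u m - series u n|) @ \oo -->
    `|rseries u - series u n|.
  by apply: cvg_norm; apply: cvgB => //; exact: cvg_cst.
have cw' : (fun m => series w m - series w n) @ \oo --> tail w n.
  by apply: cvgB => //; exact: cvg_cst.
apply: (ler_cvg_to cu' cw'); near=> m.
have nm : (n <= m)%N by near: m; exact: nbhs_infty_ge.
rewrite !sub_series_geq//= (le_trans (ler_norm_sum _ _ _))//.
exact: ler_sum.
Unshelve. all: by end_near. Qed.

Lemma rseriesD (u v : nat -> R) : cvgn (series u) -> cvgn (series v) ->
  rseries (fun n => u n + v n) = rseries u + rseries v.
Proof.
move=> cu cv; apply/cvg_lim => //.
under eq_fun do rewrite big_split /=.
exact: cvgD.
Qed.

Lemma is_cvg_geometric (M beta : R) : 0 < beta < 1 ->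
  cvgn (series (fun n => M * beta ^+ n)).
Proof.
move=> /andP[b0 b1]; apply: is_cvg_geometric_series.
by rewrite gtr0_norm.
Qed.

Lemma series_eventually0 (u : nat -> R) N :
  (forall n, (N <= n)%N -> u n = 0) ->
  series u @ \oo --> \sum_(0 <= k < N) u k.
Proof.
move=> u0; apply: cvg_near_cst; near=> n.
have Nn : (N <= n)%N by near: n; exact: nbhs_infty_ge.
rewrite /series /= (big_cat_nat _ Nn)//= [X in _ + X]big1_seq ?addr0// => k.
by rewrite mem_index_iota => /andP[_ /andP[/u0]].
Unshelve. all: by end_near. Qed.

End SeriesTail.

(** * Path probabilities, locality and tameness of continuation values *)

Section ModelLemmas.
Context {R : realType} {S : finType} {A : finPointedType} {X : countType}
  {nI : nat}.
Variables (pi : S -> S -> R) (zeta : X -> A -> S -> X) (beta : R).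
Hypothesis pi_gt0 : forall s s', 0 < pi s s'.
Hypothesis pi_sum : forall s, \sum_(s' : S) pi s s' = 1.
Hypothesis beta01 : 0 < beta < 1.
Local Notation plan := (@plan S A).
Local Notation shist := (@shist S).
Local Notation preh := (@preh S A).

Lemma pathprob_gt0 s c : 0 < pathprob pi s c.
Proof. by elim: c s => //= s' c IH s; rewrite mulr_gt0. Qed.

Lemma sum_pathprob n s : \sum_(c : n.-tuple S) pathprob pi s c = 1.
Proof.
elim: n s => [|n IH] s.
  rewrite (bigD1 [tuple])//= big1 ?addr0// => c /eqP c0.
  by case: c0; exact: tuple0.
rewrite (reindex (fun x : S * n.-tuple S => [tuple of x.1 :: x.2])) /=; last first.
  exists (fun c : n.+1.-tuple S => (thead c, [tuple of behead c])).
    by move=> [x c] _ /=; congr pair; apply: val_inj.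
  by move=> c _ /=; rewrite -tuple_eta.
rewrite -(pair_big xpredT xpredT
  (fun x (c : n.-tuple S) => pi s x * pathprob pi x c)) /=.
under eq_bigr do rewrite -mulr_sumr IH mulr1.
exact: pi_sum.
Qed.

Lemma condED h n f1 f2 : condE pi h n (fun h' => f1 h' + f2 h') =
  condE pi h n f1 + condE pi h n f2.
Proof. by rewrite /condE -big_split; apply: eq_bigr => c _; rewrite mulrDr. Qed.

Lemma condE_norm h n f (M : R) :
  (forall h', `|f h'| <= M) -> `|condE pi h n f| <= M.
Proof.
move=> fM; rewrite (le_trans (ler_norm_sum _ _ _))//.
rewrite -[leRHS]mul1r -(sum_pathprob n (cur h)) mulr_suml ler_sum// => c _.
have p0 := pathprob_gt0 (cur h) c.
by rewrite normrM gtr0_norm// ler_pM2l.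
Qed.

(** Values at a history involve only the branch of the plan that starts at the same initial shock,
    so plans can be changed on other branches. *)
Definition agree_from (s : S) (n : nat) (a b : plan) : Prop :=
  forall c, (size c <= n)%N -> a (s, c) = b (s, c).

Lemma agree_agree_from s n a b : agree n a b -> agree_from s n a b.
Proof. by move=> ab c cn; apply: ab. Qed.

Lemma xk_agree x0 (h : shist) k n a b : agree_from h.1 n a b ->
  (size h.2 <= n)%N -> xk zeta x0 a h k = xk zeta x0 b h k.
Proof.
move=> ab hn; elim: k => //= k ->; rewrite ab// size_take.
by case: ltnP => // kh; rewrite (leq_trans (ltnW kh)).
Qed.

Lemma xof_agree x0 (h : shist) n a b : agree_from h.1 n a b ->
  (size h.2 <= n)%N -> xof zeta x0 a h = xof zeta x0 b h.
Proof. exact: xk_agree. Qed.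

Lemma acts_agree (h : shist) n a b : agree_from h.1 n a b ->
  (size h.2 <= n)%N -> acts a h = acts b h.
Proof.
move=> ab hn; apply: eq_map => k; rewrite ab// size_take.
by case: ltnP => // kh; rewrite (leq_trans (ltnW kh)).
Qed.

Lemma condE_agree x0 (f : X -> A -> S -> R) (h : shist) m n a b :
  agree_from h.1 n a b -> (size h.2 + m <= n)%N ->
  condE pi h m (fun h' => f (xof zeta x0 a h') (a h') (cur h')) =
  condE pi h m (fun h' => f (xof zeta x0 b h') (b h') (cur h')).
Proof.
move=> ab hn; apply: eq_bigr => c _.
have cn : (size (extend h c).2 <= n)%N by rewrite size_cat size_tuple.
by rewrite (xof_agree (h := extend h c) x0 ab)// ab.
Qed.

Lemma contval_agree x0 (f : X -> A -> S -> R) (h : shist) a b :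
  (forall c, a (h.1, c) = b (h.1, c)) ->
  contval pi zeta beta x0 a f h = contval pi zeta beta x0 b f h.
Proof.
move=> ab; congr rseries; apply/funext => m; congr (_ * _).
by apply: (@condE_agree x0 f h m (size h.2 + m)%N) => // c _.
Qed.

Lemma contval_term_norm x0 (f : X -> A -> S -> R) (h : shist) a (M : R) :
  (forall x b s, `|f x b s| <= M) -> forall n,
  `|beta ^+ n * condE pi h n (fun h' => f (xof zeta x0 a h') (a h') (cur h'))|
    <= M * beta ^+ n.
Proof.
move=> fM n; have /andP[b0 _] := beta01.
rewrite normrM gtr0_norm ?exprn_gt0//.
by rewrite [leRHS]mulrC ler_pM2l ?exprn_gt0// condE_norm.
Qed.

Definition contval_trunc x0 a (f : X -> A -> S -> R) (h : shist) N : R :=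
  \sum_(0 <= n < N) beta ^+ n *
    condE pi h n (fun h' => f (xof zeta x0 a h') (a h') (cur h')).

Lemma contval_tail x0 f h a (M : R) N : (forall x b s, `|f x b s| <= M) ->
  `|contval pi zeta beta x0 a f h - contval_trunc x0 a f h N|
    <= tail (fun n => M * beta ^+ n) N.
Proof.
move=> fM; have := rseries_tail (contval_term_norm x0 h a fM).
by move=> /(_ (is_cvg_geometric (M := M) beta01))[_]; exact.
Qed.

Lemma contval_norm x0 f h a (M : R) : (forall x b s, `|f x b s| <= M) ->
  `|contval pi zeta beta x0 a f h| <= rseries (fun n => M * beta ^+ n).
Proof.
move=> fM; have := contval_tail x0 h a 0 fM.
by rewrite /contval_trunc /tail !big_geq// !subr0.
Qed.

Lemma condE_cylinder x0 f h n : cylinder (fun a =>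
  condE pi h n (fun h' => f (xof zeta x0 a h') (a h') (cur h'))).
Proof.
exists (size h.2 + n)%N => a b ab.
apply: (@condE_agree x0 f h n (size h.2 + n)%N) => //.
exact: agree_agree_from.
Qed.

Lemma contval_trunc_cylinder x0 f h N :
  cylinder (fun a => contval_trunc x0 a f h N).
Proof.
apply: cylinder_sum => n.
by apply: (cylinder_comp ( *%R (beta ^+ n))); exact: condE_cylinder.
Qed.

(** Partial sums are cylinder functions, and discounting bounds the remainder uniformly over
    plans. *)
Lemma contval_tame x0 f h (M : R) : (forall x b s, `|f x b s| <= M) ->
  tame (fun a => contval pi zeta beta x0 a f h).
Proof.
move=> fM e e0.
have /cvgr0_norm_le/(_ _ e0)[N _ /(_ N (leqnn N)) Ne] :=
  tail_cvg0 (is_cvg_geometric (M := M) beta01).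
exists (fun a => contval_trunc x0 a f h N); first exact: contval_trunc_cylinder.
move=> a; rewrite (le_trans (contval_tail x0 h a N fM))//.
exact: le_trans (ler_norm _) Ne.
Qed.

Lemma acts_cylinder (h : shist) : cylinder (fun a : plan => acts a h).
Proof.
exists (size h.2) => a b ab.
exact: (acts_agree (n := size h.2) (agree_agree_from _ ab)).
Qed.

(** * Weighted sums over pre-action histories *)

Section PathSum.
Variable s0 : S.

(** Shocks are averaged but action strings are merely summed, as in the summability condition of
    [Lambda]. *)
Definition pathsum t (u : 'I_nI -> preh -> R) : R :=
  \sum_(tl : t.-tuple S) \sum_(ac : t.-tuple A) \sum_(i < nI)
    pathprob pi s0 tl * u i (mkpreh s0 tl ac).

Lemma pathsumD t u v : pathsum t (fun i hp => u i hp + v i hp) =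
  pathsum t u + pathsum t v.
Proof.
rewrite /pathsum -big_split; apply: eq_bigr => tl _.
rewrite -big_split; apply: eq_bigr => ac _.
by rewrite -big_split; apply: eq_bigr => i _; rewrite mulrDr.
Qed.

Lemma pathsumZ t k u : pathsum t (fun i hp => k * u i hp) = k * pathsum t u.
Proof.
rewrite /pathsum mulr_sumr; apply: eq_bigr => tl _.
rewrite mulr_sumr; apply: eq_bigr => ac _.
by rewrite mulr_sumr; apply: eq_bigr => i _; rewrite mulrCA.
Qed.

Lemma le_pathsum t u v : (forall i hp, u i hp <= v i hp) ->
  pathsum t u <= pathsum t v.
Proof.
move=> uv; apply: ler_sum => tl _; apply: ler_sum => ac _.
apply: ler_sum => i _.
by rewrite ler_pM2l ?pathprob_gt0.
Qed.

Lemma pathsum0 t : pathsum t (fun _ _ => 0) = 0.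
Proof. by have := pathsumZ t 0 (fun _ _ => 0); rewrite !mul0r. Qed.

Lemma pathsum_ge0 t u : (forall i hp, 0 <= u i hp) -> 0 <= pathsum t u.
Proof. by move=> u0; rewrite -[leLHS](pathsum0 t) le_pathsum. Qed.

Lemma pathsum_tame t (u : plan -> 'I_nI -> preh -> R) :
  (forall i hp, tame (fun a => u a i hp)) -> tame (fun a => pathsum t (u a)).
Proof.
move=> tu; apply: tame_sum => tl; apply: tame_sum => ac; apply: tame_sum => i.
exact: tameZ.
Qed.

Lemma expect_pathsum P t (u : plan -> 'I_nI -> preh -> R) :
  (forall i hp, tame (fun a => u a i hp)) ->
  expect P (fun a => pathsum t (u a)) =
  pathsum t (fun i hp => expect P (fun a => u a i hp)).
Proof.
move=> tu; have tZ (tl : t.-tuple S) (ac : t.-tuple A) i :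
  tame (fun a => pathprob pi s0 tl * u a i (mkpreh s0 tl ac)) by exact: tameZ.
rewrite expect_sum => [|tl]; last by do 2 apply: tame_sum => ?.
apply: eq_bigr => tl _; rewrite expect_sum => [|ac]; last exact: tame_sum.
apply: eq_bigr => ac _; rewrite expect_sum//.
by apply: eq_bigr => i _; rewrite expectZ.
Qed.

Lemma eq_pathsum t u v : (forall i hp, (sval hp).1.1 = s0 ->
  size (sval hp).1.2 = t -> u i hp = v i hp) -> pathsum t u = pathsum t v.
Proof.
move=> uv; apply: eq_bigr => tl _; apply: eq_bigr => ac _.
apply: eq_bigr => i _.
by rewrite uv//= size_tuple.
Qed.

Lemma pathsum_ge_term u i hp : (forall i hp, 0 <= u i hp) ->
  (sval hp).1.1 = s0 ->
  pathprob pi s0 (sval hp).1.2 * u i hp <= pathsum (size (sval hp).1.2) u.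
Proof.
move=> u0; case: hp => [[[s c] ac] acc] /= ss0; subst s; rewrite /= in acc *.
rewrite /pathsum (bigD1 (in_tuple c))//= (bigD1 (Tuple acc))//= (bigD1 i)//=.
have -> : mkpreh s0 (in_tuple c) (Tuple acc) =
  exist (fun hp : shist * seq A => size hp.2 == size hp.1.2) (s0, c, ac) acc.
  exact: val_inj.
rewrite -!addrA lerDl; do ![apply: addr_ge0]; do ?[apply: sumr_ge0 => ? _];
  by rewrite mulr_ge0// ltW// pathprob_gt0.
Qed.

Lemma Lambda_pathsum lam t : \sum_(s : S) \sum_(tl : t.-tuple S)
    \sum_(ac : t.-tuple A) \sum_(i < nI)
      lam i (mkpreh s tl ac) * pit pi s0 (s, (tl : seq S)) = pathsum t lam.
Proof.
rewrite (bigD1 s0)//= [X in _ + X]big1 ?addr0 => [|s ss0].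
  apply: eq_bigr => tl _; apply: eq_bigr => ac _.
apply: eq_bigr => i _.
  by rewrite /pit /= eqxx mulrC.
rewrite big1// => tl _; rewrite big1// => ac _; rewrite big1// => i _.
by rewrite /pit /= (negbTE ss0) mulr0.
Qed.

(** Along a shock path the plan generates exactly one action string, so the indicator leaves one
    term of the sum over strings. *)
Lemma condE_pathsum t (a : plan) (lam : 'I_nI -> preh -> R)
    (F : 'I_nI -> shist -> R) :
  condE pi (s0, [::]) t (fun h => \sum_(i < nI) lam i (genh a h) * F i h) =
  pathsum t (fun i hp => lam i hp *
    ((acts a (sval hp).1 == (sval hp).2)%:R * F i (sval hp).1)).
Proof.
rewrite /condE /pathsum; apply: eq_bigr => tl _.
rewrite /extend /= mulr_sumr exchange_big /=; apply: eq_bigr => i _.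
(* The length of [acts] is [size tl], which equals [t] only up to a proof, hence the cast. *)
pose at_ := tcast (size_tuple tl) (Tuple (acts_size a (s0, (tl : seq S)))).
have atE : at_ = acts a (s0, (tl : seq S)) :> seq A by rewrite val_tcast.
rewrite (bigD1 at_)//= [X in _ + X]big1 ?addr0.
  rewrite atE eqxx mul1r; congr (_ * (lam i _ * _)).
  by apply: val_inj; rewrite /= atE.
move=> ac aca; rewrite (_ : _ == _ = false) ?mul0r ?mulr0//.
apply: contra_neqF aca => /eqP aE; apply: val_inj.
by rewrite /= atE aE.
Qed.

End PathSum.
End ModelLemmas.

(** * Duality *)

Lemma bounded_family (R : realType) n (T : Type) (f : 'I_n -> T -> R) :
  (forall i, exists M, forall x, `|f i x| <= M) ->
  exists M, forall i x, `|f i x| <= M.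
Proof.
move=> /choice[M fM]; exists (\sum_i `|M i|) => i x.
rewrite (le_trans (fM i x))// (le_trans (ler_norm _))//.
by rewrite (bigD1 i)//= lerDl sumr_ge0.
Qed.

Lemma ereal_le_of_lt (R : realType) (x y : \bar R) :
  (forall v : R, (v%:E < x)%E -> (v%:E <= y)%E) -> (x <= y)%E.
Proof.
case: x => [x| |] xy; last exact: leNye.
  apply/lee_addgt0Pr => e e0; rewrite -leeBlDr// -EFinB xy// lte_fin.
  by rewrite ltrBlDr ltrDl.
by rewrite (eq_infty (fun v => xy v (ltry v))).
Qed.

Section Duality.
Context {R : realType} {S : finType} {A : finPointedType} {X : countType}
  {nI : nat}.
Variables (pi : S -> S -> R) (zeta : X -> A -> S -> X).
Variables (p r : X -> A -> S -> R) (g : 'I_nI -> X -> A -> S -> R).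
Variables (gbar : 'I_nI -> R) (beta : R) (gamma : 'I_nI -> R).
Variables (x0 : X) (s0 : S).
Hypothesis pi_gt0 : forall s s', 0 < pi s s'.
Hypothesis pi_sum : forall s, \sum_(s' : S) pi s s' = 1.
Hypothesis beta01 : 0 < beta < 1.
Hypothesis r_bounded : exists M : R, forall x b s, `|r x b s| <= M.
Hypothesis g_bounded :
  forall i, exists M : R, forall x b s, `|g i x b s| <= M.
Local Notation plan := (@plan S A).
Local Notation shist := (@shist S).
Local Notation preh := (@preh S A).
Local Notation pathsum := (@pathsum R S A nI pi s0).
Local Notation obj := (objective pi zeta r g beta gamma x0 s0).

Let payoff (x : X) (b : A) (s : S) : R :=
  r x b s + \sum_(i < nI) gamma i * g i x b s.

Let obj_term (a : plan) (t : nat) : R := beta ^+ t *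
  condE pi (s0, [::]) t (fun h => payoff (xof zeta x0 a h) (a h) (cur h)).

Let slack (a : plan) (i : 'I_nI) (h : shist) : R :=
  contval pi zeta beta x0 a (g i) h - gbar i.

(** The integrand of the lottery constraint at [hp]. *)
Let cslack (a : plan) (i : 'I_nI) (hp : preh) : R :=
  (acts a (sval hp).1 == (sval hp).2)%:R * slack a i (sval hp).1.

Let payoff_bounded : exists M : R, forall x b s, `|payoff x b s| <= M.
Proof.
have [M rM] := r_bounded; have /choice[G gG] := g_bounded.
exists (M + \sum_i `|gamma i| * G i) => x b s.
rewrite (le_trans (ler_normD _ _))// lerD// (le_trans (ler_norm_sum _ _ _))//.
by apply: ler_sum => i _; rewrite normrM ler_wpM2l.
Qed.

Let slack_bounded : exists B : R, forall i a h, `|slack a i h| <= B.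
Proof.
have /choice[G gG] := g_bounded.
have [|B HB] := @bounded_family R nI (plan * shist)
    (fun i x => slack x.1 i x.2).
  move=> i; exists (rseries (fun n => G i * beta ^+ n) + `|gbar i|) => -[a h] /=.
  by rewrite (le_trans (ler_normB _ _))// lerD2r contval_norm.
by exists B => i a h; exact: (HB i (a, h)).
Qed.

Let cslack_norm (B : R) : (forall i a h, `|slack a i h| <= B) ->
  forall i a hp, `|cslack a i hp| <= B.
Proof.
move=> sB i a hp; rewrite /cslack.
case: (_ == _); first by rewrite mul1r.
by rewrite mul0r normr0 (le_trans _ (sB i a (sval hp).1)).
Qed.

Let obj_tame : tame obj.
Proof.
have [M pM] := payoff_bounded.
exact: (contval_tame zeta pi_gt0 pi_sum beta01 x0 _ pM).
Qed.

Let cslack_tame i hp : tame (fun a => cslack a i hp).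
Proof.
have [M gM] := g_bounded i; apply: cylinderM_tame.
  exact: (cylinder_comp (fun w => (w == (sval hp).2)%:R) (acts_cylinder _)).
apply: tameB; last exact: tame_cst.
exact: (contval_tame zeta pi_gt0 pi_sum beta01 x0 _ gM).
Qed.

(** In this form the multipliers no longer depend on the plan, so they come out of integrals over
    plans. *)
Let LagrE a lam : Lagr pi zeta r g gbar beta gamma x0 s0 a lam =
  rseries (fun t => obj_term a t +
    beta ^+ t * pathsum t (fun i hp => lam i hp * cslack a i hp)).
Proof.
congr rseries; apply/funext => t.
by rewrite condED mulrDr (condE_pathsum pi s0 t a lam (slack a)).
Qed.

Let obj_series a : cvgn (series (obj_term a)).
Proof.
have [M pM] := payoff_bounded.
exact: (rseries_tail (contval_term_norm zeta pi_gt0 pi_sum beta01 x0 _ a pM)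
  (is_cvg_geometric (M := M) beta01)).1.
Qed.

Let beta_gt0 t : 0 < beta ^+ t.
Proof. by have /andP[b0 _] := beta01; rewrite exprn_gt0. Qed.

(** Admissibility concerns all dates; these cylinders decrease to it. *)
Let Ainf_upto n : set (@planM S A) :=
  [set a | forall h : shist, (size h.2 <= n)%N ->
    0 <= p (xof zeta x0 a h) (a h) (cur h)].

Let Ainf_upto_cylinder n : cylinder (Ainf_upto n).
Proof.
exists n => a b ab; rewrite /Ainf_upto /=.
suff E h : (size h.2 <= n)%N ->
    p (xof zeta x0 a h) (a h) (cur h) = p (xof zeta x0 b h) (b h) (cur h).
  by apply/propext; split => Ha h hn; [rewrite -E//|rewrite E//]; exact: Ha.
by move=> hn; rewrite (xof_agree (n := n) zeta x0 (agree_agree_from _ ab))// ab.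
Qed.

Let AinfE : Ainf zeta p x0 = \bigcap_n Ainf_upto n.
Proof.
apply/seteqP; split=> [a Ha n _ h _|a Ha h]; first exact: Ha.
exact: (Ha (size h.2)).
Qed.

Let Ainf_measurable : measurable (Ainf zeta p x0 : set (@planM S A)).
Proof.
rewrite AinfE; apply: bigcapT_measurable => n.
exact: cylinder_measurable.
Qed.

(** Multipliers are nonnegative, so under a feasible lottery every constraint term of the Lagrangian
    has nonnegative expectation. *)
Lemma weak_duality P lam : feasible_lottery pi zeta p g gbar beta x0 s0 P ->
  Lambda pi beta s0 lam ->
  (\int[P]_(a in [set: @planM S A]) (obj a)%:E <=
   ereal_sup [set (Lagr pi zeta r g gbar beta gamma x0 s0 a lam)%:E
             | a in Ainf zeta p x0])%E.
Proof.
move=> [PA Pc] [lam0 lamS].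
rewrite integral_expect//.
set d := ereal_sup _.
have dL a : Ainf zeta p x0 a ->
    ((Lagr pi zeta r g gbar beta gamma x0 s0 a lam)%:E <= d)%E.
  by move=> Aa; apply: ereal_sup_ubound; exists a.
(* A supremum of minus infinity would leave no admissible plan, against [P] having mass one on
   them. *)
case: d dL => [d| |] dL; [|by rewrite leey|]; last first.
  suff A0 : Ainf zeta p x0 = set0 :> set (@planM S A).
    by have := PA; rewrite A0 measure0 => /eqP; rewrite eqe eq_sym oner_eq0.
  by apply/seteqP; split => // a /dL; rewrite leeNy_eq.
have [M pM] := payoff_bounded; have [B sB] := slack_bounded.
(* The discounted multiplier mass at date [t]; its summability is the content of [Lambda], and it
   yields the majorant [w] below. *)
pose W t := beta ^+ t * pathsum t lam.
have W0 t : 0 <= W t.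
  apply: mulr_ge0; first exact: ltW.
  rewrite -[leLHS](@pathsum0 R S A nI pi s0 t) le_pathsum//; exact: lam0.
have cW : cvgn (series W).
  move: lamS; under eq_eseriesr do rewrite Lambda_pathsum.
  move=> lamS.
  have WS N : ((series W N)%:E <= \sum_(0 <= t <oo) (W t)%:E)%E.
    by rewrite -sumEFin; apply: nneseries_lim_ge => t _ _; rewrite lee_fin.
  apply: nondecreasing_is_cvgn.
    by apply/nondecreasing_seqP => N; rewrite /series /= big_nat_recr//= lerDl.
  exists (fine (\sum_(0 <= t <oo) (W t)%:E)%E) => _ [N _ <-].
  rewrite -lee_fin fineK; first exact: WS.
  by rewrite ge0_fin_numE//; apply: nneseries_ge0 => t _ _; rewrite lee_fin.
pose w t := M * beta ^+ t + B * W t.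
have cM := is_cvg_geometric (M := M) beta01.
have cw : cvgn (series w).
  have -> : series w = (fun n =>
      series (fun t => M * beta ^+ t) n + B * series W n).
    by apply/funext => n; rewrite /series /= big_split /= mulr_sumr.
  by apply: is_cvgD => //; apply: is_cvgM => //; exact: is_cvg_cst.
pose viol a t := beta ^+ t * pathsum t (fun i hp => lam i hp * cslack a i hp).
have violW a t : `|viol a t| <= B * W t.
  rewrite normrM gtr0_norm// mulrCA ler_pM2l// -pathsumZ ler_norml.
  apply/andP; split.
    rewrite -mulN1r -pathsumZ; apply: le_pathsum => // i hp.
    have := cslack_norm sB i a hp; rewrite ler_norml => /andP[cB _].
    by rewrite mulN1r [B * _]mulrC -mulrN ler_wpM2l.
  apply: le_pathsum => // i hp; rewrite [leRHS]mulrC ler_wpM2l//.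
  by rewrite (le_trans (ler_norm _))// cslack_norm.
pose Lt T a := \sum_(0 <= t < T) (obj_term a t + viol a t).
have LT a T :
    `|Lagr pi zeta r g gbar beta gamma x0 s0 a lam - Lt T a| <= tail w T.
  rewrite LagrE; apply: (rseries_tail _ cw).2 => t.
  rewrite (le_trans (ler_normD _ _))// lerD ?violW//.
  exact: (contval_term_norm zeta pi_gt0 pi_sum beta01 x0 _ a pM).
have OT a T : `|obj a - \sum_(0 <= t < T) obj_term a t| <=
    tail (fun n => M * beta ^+ n) T.
  exact: (contval_tail zeta pi_gt0 pi_sum beta01 x0 _ a _ pM).
have obj_term_tame t : tame (fun a => obj_term a t).
  by apply/tameZ/tame_cylinder; exact: condE_cylinder.
have lam_tame i hp : tame (fun a => lam i hp * cslack a i hp) by exact: tameZ.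
have viol_tame t : tame (fun a => viol a t) by apply: tameZ; exact: pathsum_tame.
have viol_ge0 t : 0 <= expect P (fun a => viol a t).
  rewrite expectZ; last exact: pathsum_tame.
  rewrite expect_pathsum//; apply: mulr_ge0; first exact: ltW.
  apply: pathsum_ge0 => // i hp.
  by rewrite expectZ// mulr_ge0// -lee_fin -integral_expect//; exact: Pc.
rewrite lee_fin; apply/ler_addgt0Pr => e e0.
have e3 : 0 < e / 3 by rewrite divr_gt0.
have [T [Tw TM]] : exists T, tail w T <= e / 3 /\
    tail (fun n => M * beta ^+ n) T <= e / 3.
  have /cvgr_le/(_ _ e3) wT := tail_cvg0 cw.
  have /cvgr_le/(_ _ e3) MT := tail_cvg0 cM.
  by have [T [? ?]] := filter_ex (filterI wT MT); exists T.
have LT_tame : tame (Lt T) by apply: tame_sum => t; exact: tameD.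
have oT_tame : tame (fun a => \sum_(0 <= t < T) obj_term a t).
  exact: tame_sum.
have : expect P (Lt T) <= d + e / 3.
  rewrite -(expect_cst P (d + e / 3)); apply: (expect_le Ainf_measurable PA) => //.
    exact: tame_cst.
  by move=> a /dL; have := LT a T; rewrite lee_fin ler_norml; lra.
have : expect P obj <=
    expect P (fun a => \sum_(0 <= t < T) obj_term a t) + e / 3.
  rewrite -(expect_cst P (e / 3)) -expectD//; last exact: tame_cst.
  apply: (expect_le Ainf_measurable PA) => //.
    by apply: tameD => //; exact: tame_cst.
  by move=> a _; have := OT a T; rewrite ler_norml; lra.
suff : expect P (fun a => \sum_(0 <= t < T) obj_term a t) <=
  expect P (Lt T) by lra.
rewrite !expect_sum//; last by move=> t; exact: tameD.
by apply: ler_sum => t _; rewrite expectD// lerDl.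
Qed.

(** * Strong duality through a repeated game *)

Let constr : Type := option ('I_nI * preh).

(* The constraints are weighted as in the Lagrangian, truncated at [T]. *)
Let pairing (T : nat) (u : constr -> R) : R := u None +
  \sum_(0 <= t < T) beta ^+ t * pathsum t (fun i hp => u (Some (i, hp))).

Let pairingD T u v :
  pairing T (fun j => u j + v j) = pairing T u + pairing T v.
Proof.
rewrite /pairing addrACA -big_split; congr (_ + _); apply: eq_bigr => t _.
by rewrite pathsumD mulrDr.
Qed.

Let pairingZ T k u : pairing T (fun j => k * u j) = k * pairing T u.
Proof.
rewrite /pairing mulrDr mulr_sumr; congr (_ + _); apply: eq_bigr => t _.
by rewrite pathsumZ mulrCA.
Qed.

Let le_pairing T u v : (forall j, u j <= v j) -> pairing T u <= pairing T v.
Proof.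
move=> uv; apply: lerD => //; apply: ler_sum => t _.
by rewrite ler_pM2l//; exact: le_pathsum.
Qed.

(** The factor [1] is the weight of this component, in the form that [good_lists] expects. *)
Let pairing_ge_None T u : (forall j, 0 <= u j) -> 1 * u None <= pairing T u.
Proof.
move=> u0; rewrite mul1r lerDl sumr_ge0// => t _.
by apply: mulr_ge0; [exact: ltW|exact: pathsum_ge0].
Qed.

Let pairing_ge_Some T u i hp : (forall j, 0 <= u j) -> (sval hp).1.1 = s0 ->
  (size (sval hp).1.2 < T)%N ->
  (beta ^+ size (sval hp).1.2 * pathprob pi s0 (sval hp).1.2) * u (Some (i, hp))
    <= pairing T u.
Proof.
move=> u0 hs0 hT; rewrite /pairing big_mkord (bigD1 (Ordinal hT))//= addrCA.
apply: ler_wpDr.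
  rewrite addr_ge0// sumr_ge0// => t _.
  by apply: mulr_ge0; [exact: ltW|exact: pathsum_ge0].
rewrite -mulrA ler_pM2l//.
exact: (pathsum_ge_term pi_gt0 (u := fun i hp => u (Some (i, hp)))).
Qed.

Variable af : plan.
Hypothesis af_feasible : feasible_plan pi zeta p g gbar beta x0 s0 af.

(** Lottery constraints range over every initial shock, while the Lagrangian sees [s0] only.
    Following [af] on the other branches meets the remaining constraints and leaves the Lagrangian
    unchanged. *)
Let merge (a : plan) : plan := fun h => if h.1 == s0 then a h else af h.

Let K : set plan :=
  [set a | Ainf zeta p x0 a /\ forall h : shist, h.1 != s0 -> a h = af h].

Let merge_root a c : merge a (s0, c) = a (s0, c).
Proof. by rewrite /merge eqxx. Qed.

Let K_merge a : Ainf zeta p x0 a -> K (merge a).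
Proof.
move=> Aa; split=> [h|h hs0]; last by rewrite /merge (negbTE hs0).
have [hs0|hs0] := eqVneq h.1 s0.
  rewrite (@xof_agree _ _ _ zeta x0 h (size h.2) _ a)//; last first.
    by move=> c _; rewrite hs0 merge_root.
  by rewrite /merge hs0 eqxx; exact: Aa.
rewrite (@xof_agree _ _ _ zeta x0 h (size h.2) _ af)//; last first.
  by move=> c _; rewrite /merge (negbTE hs0).
by rewrite /merge (negbTE hs0); exact: af_feasible.1.
Qed.

Let obj_merge a : obj (merge a) = obj a.
Proof. by apply: contval_agree => c /=; rewrite merge_root. Qed.

Let cslack_merge a i hp : (sval hp).1.1 = s0 ->
  cslack (merge a) i hp = cslack a i hp.
Proof.
move=> hs0; have ma c : merge a ((sval hp).1.1, c) = a ((sval hp).1.1, c).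
  by rewrite hs0 merge_root.
rewrite /cslack /slack (contval_agree _ _ _ _ _ ma).
by rewrite (@acts_agree _ _ (sval hp).1 (size (sval hp).1.2) _ a)// => c _.
Qed.

Variable v : R.
Hypothesis v_lt : (v%:E < Dval pi zeta p r g gbar beta gamma x0 s0)%E.

(** The payoff vector of the game; [None] is the objective in excess of the target [v]. *)
Let score (a : plan) (j : constr) : R :=
  if j is Some (i, hp) then cslack a i hp else obj a - v.

Let score_bounded : exists B, forall a j, `|score a j| <= B.
Proof.
have [M oM] := tame_bounded obj_tame; have [B sB] := slack_bounded.
exists ((M + `|v|) + `|B|) => a [[i hp]|] /=.
  rewrite (le_trans (cslack_norm sB i a hp))// (le_trans (ler_norm _))//.
  by rewrite lerDr addr_ge0// (le_trans _ (oM a)).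
by rewrite (le_trans (ler_normB _ _))// -[leLHS]addr0 lerD// lerD2r.
Qed.

Let respond T (lam : constr -> R) : (forall j, 0 <= lam j) ->
  exists2 a, K a & 0 <= pairing T (fun j => lam j * score a j).
Proof.
move=> lam0; have [l0|l0] := eqVneq (lam None) 0.
  exists af; first by split=> //; exact: af_feasible.1.
  rewrite /pairing l0 mul0r add0r sumr_ge0// => t _.
  apply: mulr_ge0; first exact: ltW.
  apply: pathsum_ge0 => // i hp; rewrite mulr_ge0// mulr_ge0 ?ler0n//.
  by rewrite subr_ge0; exact: af_feasible.2.
have l_gt0 : 0 < lam None by rewrite lt_def l0 lam0.
(* Normalizing the objective to weight one gives true multipliers; cut off at [T], they match
   [pairing T] and are summable. *)
pose mult (i : 'I_nI) (hp : preh) : R :=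
  if (size (sval hp).1.2 < T)%N then lam (Some (i, hp)) / lam None else 0.
have mult_late t (u : 'I_nI -> preh -> R) : (T <= t)%N ->
    pathsum t (fun i hp => mult i hp * u i hp) = 0.
  move=> Tt; rewrite -[RHS](@pathsum0 R S A nI pi s0 t).
  apply: eq_pathsum => i hp _ hpt.
  by rewrite /mult hpt ltnNge Tt mul0r.
have multL : Lambda pi beta s0 mult.
  split=> [i hp|].
    by rewrite /mult; case: ifP => // _; rewrite divr_ge0// ltW.
  under eq_eseriesr do rewrite Lambda_pathsum.
  rewrite (_ : limn _ = (\sum_(0 <= t < T) beta ^+ t * pathsum t mult)%:E).
    exact: ltry.
  apply/cvg_lim => //; apply: cvg_near_cst; near=> n.
  have Tn : (T <= n)%N by near: n; exact: nbhs_infty_ge.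
  rewrite sumEFin; congr (_%:E).
  rewrite (big_cat_nat _ Tn)//= [X in _ + X]big1_seq ?addr0// => k.
  rewrite mem_index_iota => /andP[_ /andP[Tk _]].
  have := mult_late _ (fun _ _ => 1) Tk.
  rewrite (_ : (fun i hp => _) = mult) => [->|]; first by rewrite mulr0.
  by apply/funext => i; apply/funext => hp; rewrite mulr1.
have : (v%:E < ereal_sup [set (Lagr pi zeta r g gbar beta gamma x0 s0 a mult)%:E
    | a in Ainf zeta p x0])%E.
  by apply: lt_le_trans v_lt _; apply: ereal_inf_lbound; exists mult.
move=> /ereal_sup_gt[_ [a Aa <-]]; rewrite lte_fin LagrE => va.
exists (merge a); first exact: K_merge.
pose viol t := beta ^+ t * pathsum t (fun i hp => mult i hp * cslack a i hp).
have viol0 t : (T <= t)%N -> viol t = 0.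
  by move=> Tt; rewrite /viol mult_late// mulr0.
have LE : rseries (fun t => obj_term a t + viol t) =
    obj a + \sum_(0 <= t < T) viol t.
  have violc := series_eventually0 viol0.
  rewrite rseriesD//; last by apply/cvg_ex; eexists; exact: violc.
  by congr (_ + _); exact: cvg_lim violc.
(* The pairing is [lam None] times the excess of the Lagrangian over [v]. *)
rewrite (_ : pairing _ _ = lam None * (obj a + \sum_(0 <= t < T) viol t - v)).
  by rewrite mulr_ge0// subr_ge0 -LE ltW.
rewrite /pairing /= obj_merge addrAC [RHS]mulrDr mulr_sumr; congr (_ + _).
apply: eq_big_nat => t /andP[_ tT]; rewrite /viol [RHS]mulrCA.
congr (_ * _); rewrite -pathsumZ.
apply: eq_pathsum => i hp hs0 ht.
by rewrite cslack_merge// /mult ht tT mulrA [lam None * _]mulrC divfK.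
Unshelve. all: by end_near. Qed.

(** [w] bounds from below the weight of component [j] in every pairing from horizon [N] on, so a
    bound on the weighted squared violation controls that component. *)
Let good_lists : exists l : nat -> seq plan,
  [/\ forall n, (0 < size (l n))%N, forall n, {in l n, forall a, K a} &
    forall j (w : R) N, 0 < w ->
      (forall T u, (N <= T)%N -> (forall j, 0 <= u j) ->
        w * u j <= pairing T u) ->
      forall e, 0 < e ->
        \forall T \near \oo, - e <= average l T (fun a => score a j)].
Proof.
have [B sB] := score_bounded.
pose M T := pairing T (fun=> B ^+ 2).
(* The squared average violation is at most [M T / (w * rounds T)]; this many rounds bring it below
   [1 / (w * T.+1)], however [M T] grows. *)
pose rounds T : nat := (T.+1 * (Num.bound (M T)).+1)%N.
have M_lt T : M T < (Num.bound (M T)).+1%:R.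
  apply: lt_trans (archi_boundP _) _; last by rewrite ltr_nat.
  rewrite -(mul0r (pairing T (fun=> 0))) -pairingZ; apply: le_pairing => j.
  by rewrite mul0r sqr_ge0.
have /choice[l Hl] T := approachability (pairingD T) (pairingZ T)
  (@le_pairing T) (fun a j (_ : K a) => sB a j) (@respond T) (rounds T).
exists l; split=> [n|n|j w N w0 wP e e0].
- by have [-> _ _] := Hl n.
- by have [_ ? _] := Hl n.
near=> T; have [sl _ lE] := Hl T.
rewrite /average sl; set s := \sum_(a <- l T) score a j.
have rE : (rounds T)%:R = T.+1%:R * (Num.bound (M T)).+1%:R :> R.
  by rewrite natrM.
have r0 : 0 < (rounds T)%:R :> R by rewrite ltr0n.
rewrite ler_pdivlMr// leNgt; apply/negP => se.
have NT : (N <= T)%N by near: T; exact: nbhs_infty_ge.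
have := le_trans (wP T _ NT (fun j => sqr_ge0 (negp _))) lE.
rewrite -/s -/(M T); apply/negP; rewrite -ltNge.
have sr : (e * (rounds T)%:R) ^+ 2 <= negp s ^+ 2.
  rewrite lerXn2r// ?nnegrE ?negp_ge0 ?mulr_ge0// ?ltW//.
  by rewrite /negp lt_max ltrNr -mulNr se orbT.
apply: (@lt_le_trans _ _ (w * (e * (rounds T)%:R) ^+ 2));
  last by rewrite ler_pM2l.
have wT : 1 < w * e ^+ 2 * T.+1%:R.
  rewrite -ltr_pdivrMr// mul1r; near: T.
  have we : 0 < w * e ^+ 2 by rewrite mulr_gt0// exprn_gt0.
  exact: (near_infty_natSinv_lt (PosNum we)).
have -> : w * (e * (rounds T)%:R) ^+ 2 =
    (rounds T)%:R * (w * e ^+ 2 * (rounds T)%:R) by ring.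
rewrite ltr_pM2l// rE mulrA; apply: lt_trans (M_lt T) _.
by rewrite ltr_pMl.
Unshelve. all: by end_near. Qed.

Lemma strong_duality : exists P : probability (@planM S A) R,
  feasible_lottery pi zeta p g gbar beta x0 s0 P /\
  (v%:E <= \int[P]_(a in [set: @planM S A]) (obj a)%:E)%E.
Proof.
have [l [l_gt0 lK lscore]] := good_lists.
have [U [UU sU]] := @ultraFilterLemma nat \oo _.
have [P [P_full P_ge]] := average_limit (R := R) l_gt0 UU.
exists P; split; last first.
  rewrite integral_expect// lee_fin; apply: P_ge => // e e0.
  have := lscore None 1 0%N ltr01 (fun T u _ => @pairing_ge_None T u) e e0.
  move=> near_v; apply: sU; apply: filterS near_v => n /=.
  by rewrite averageD average_cst//; lra.
split.
  (* The limit controls cylinders only; continuity from above then gives mass one to their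
     intersection. *)
  have upto1 n : P (Ainf_upto n) = 1%E.
    apply: P_full => // m a /lK[Aa _] h _; exact: Aa.
  have P0 : (P (Ainf_upto 0%N) < +oo)%E by rewrite [ltLHS]upto1 ltry.
  have mI : measurable (\bigcap_n Ainf_upto n) by rewrite -AinfE.
  have dec : {homo Ainf_upto : n m / (n <= m)%N >-> (m <= n)%O}.
    move=> n m nm; apply/subsetPset => a Ha h hn; apply: Ha.
    exact: leq_trans hn nm.
  have := nonincreasing_cvg_mu P0
    (fun n => cylinder_measurable (Ainf_upto_cylinder n)) mI dec.
  rewrite -AinfE (_ : P \o Ainf_upto = fun=> 1%E); last first.
    by apply/funext => n; exact: upto1.
  by move=> P1; rewrite -(cvg_lim _ P1)// lim_cst.
move=> hp i; rewrite [leRHS](integral_expect P (cslack_tame i hp)) lee_fin.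
apply: P_ge => // e e0; rewrite sub0r.
have [hs0|hs0] := eqVneq (sval hp).1.1 s0.
  apply: sU; apply: (lscore (Some (i, hp))
    (beta ^+ size (sval hp).1.2 * pathprob pi s0 (sval hp).1.2)
    (size (sval hp).1.2).+1) => //.
    by rewrite mulr_gt0// pathprob_gt0.
  by move=> T u hT u0; exact: pairing_ge_Some.
(* At another initial shock every plan of the lists follows the feasible [af], so the slack is
   nonnegative plan by plan. *)
apply: filterE => n; apply: (@le_trans _ _ 0); first by rewrite oppr_le0 ltW.
rewrite -(average_cst l_gt0 n 0); apply: average_le => // a /lK[_ aK].
rewrite /cslack mulr_ge0// /slack (contval_agree _ _ _ _ _ (b := af)).
  by rewrite subr_ge0; exact: af_feasible.2.
by move=> c; exact: aK.
Qed.

End Duality.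

Theorem theorem4p5 (R : realType) (S : finType) (A : finPointedType)
    (X : countType) (nI : nat)
    (pi : S -> S -> R) (zeta : X -> A -> S -> X) (p r : X -> A -> S -> R)
    (g : 'I_nI -> X -> A -> S -> R) (gbar : 'I_nI -> R) (beta : R) :
  (* Markov chain with strictly positive transition probabilities *)
  (forall s s' : S, 0 < pi s s') ->
  (forall s : S, \sum_(s' : S) pi s s' = 1) ->
  (* r and g^1, ..., g^I are bounded *)
  (exists M : R, forall x b s, `|r x b s| <= M) ->
  (forall i : 'I_nI, exists M : R, forall x b s, `|g i x b s| <= M) ->
  (0 < beta < 1) ->
  (* standing assumption: a feasible plan exists for every (x0, s0) *)
  (forall (x0 : X) (s0 : S), exists a : plan,
      feasible_plan pi zeta p g gbar beta x0 s0 a) ->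
  forall (gamma : 'I_nI -> R), (forall i, 0 <= gamma i) ->
  forall (x0 : X) (s0 : S),
    Vlot pi zeta p r g gbar beta gamma x0 s0
    = Dval pi zeta p r g gbar beta gamma x0 s0.
Proof.
move=> pi_gt0 pi_sum rb gb beta01 feas gamma _ x0 s0.
apply/eqP; rewrite eq_le; apply/andP; split.
  apply: ge_ereal_sup => _ [P PF <-]; apply: le_ereal_inf_tmp => _ [lam lamL <-].
  exact: weak_duality.
apply: ereal_le_of_lt => v vD; have [af af_feas] := feas x0 s0.
have [P [PF vP]] := strong_duality pi_gt0 pi_sum beta01 rb gb af_feas vD.
by apply: le_trans vP _; apply: ereal_sup_ubound; exists P.
Qed.
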